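(* Let $-1<\lambda\le-1/2$. Then $C_\lambda(u_1,u_2,u_3)=\phi_\lambda^{[-1]}(\phi_\lambda(u_1)+\phi_\lambda(u_2)+\phi_\lambda(u_3))$, $u_1,u_2,u_3\in[0,1]$, is a valid three-dimensional copula.
   Context: For $\lambda\neq-1,0$, $\phi_\lambda(x)=\frac{1}{\lambda(\lambda+1)}(x^{\lambda+1}-x+\lambda(1-x))$ for $x\ge0$ (value at $0$ as a limit); for $-1<\lambda<0$, $\phi_\lambda(0)=1/(\lambda+1)$ and $\phi_\lambda$ is convex and strictly decreasing on $[0,1]$ with $\phi_\lambda(1)=0$. The pseudoinverse is $\phi_\lambda^{[-1]}(t)=\phi_\lambda^{-1}(t)$ (inverse of $\phi_\lambda|_{[0,1]}$) for $0\le t<\phi_\lambda(0)$ and $\phi_\lambda^{[-1]}(t)=0$ for $t\ge\phi_\lambda(0)$. A $d$-dimensional copula is a joint CDF on $[0,1]^d$ with uniform $[0,1]$ margins. *)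

(* Defs.v *)
From HB Require Import structures.
From mathcomp Require Import all_boot all_order all_algebra.
From mathcomp Require Import all_classical all_reals all_analysis.
Set Implicit Arguments. Unset Strict Implicit. Unset Printing Implicit Defensive.
Import Order.TTheory GRing.Theory Num.Theory.
Local Open Scope classical_set_scope.
Local Open Scope ring_scope.

(* Generator: phi_lam(x) = (x^(lam+1) - x + lam (1 - x)) / (lam (lam+1)), x >= 0,
   for lam <> -1, 0.  For -1 < lam, powR 0 (lam+1) = 0, which is the limit value. *)
Definition phi (R : realType) (lam x : R) : R :=
  (x `^ (lam + 1) - x + lam * (1 - x)) / (lam * (lam + 1)).

Definition phi_pinv (R : realType) (lam t : R) : R :=
  if (0 <= t) && (t < phi lam 0)
  then xget 0 [set x : R | 0 <= x <= 1 /\ phi lam x = t]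
  else 0.

Definition C_lam (R : realType) (lam u1 u2 u3 : R) : R :=
  phi_pinv lam (phi lam u1 + phi lam u2 + phi lam u3).

Definition is_copula3 (R : realType) (C : R -> R -> R -> R) : Prop :=
  exists P : probability ((R * R) * R)%type R,
    [/\ (forall u : R, P [set x | x.1.1 <= u] = (Num.max 0 (Num.min u 1))%:E),
        (forall u : R, P [set x | x.1.2 <= u] = (Num.max 0 (Num.min u 1))%:E),
        (forall u : R, P [set x | x.2 <= u] = (Num.max 0 (Num.min u 1))%:E) &
        (forall u1 u2 u3 : R, 0 <= u1 <= 1 -> 0 <= u2 <= 1 -> 0 <= u3 <= 1 ->
           P [set x | [/\ x.1.1 <= u1, x.1.2 <= u2 & x.2 <= u3]]
           = (C u1 u2 u3)%:E)].

(* Main.v *)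
(** Write [b = - lam], [psi] for the pseudoinverse of [phi lam].  By McNeil and
    Neslehova, [psi (phi u1 + phi u2 + phi u3)] is the joint distribution
    function of [psi X1], [psi X2], [psi X3] as soon as [X = R S] with [S]
    uniform on the unit simplex, [R] independent of [S] and
    [psi t = E ((1 - t / R)_+ ^ 2)].  Such an [R] exists because [psi''] is
    nonincreasing: in the coordinate [w = psi t] it equals
    [b^3 w^(2b - 1) / (1 - w^b)^3], which increases with [w] exactly when
    [b >= 1 / 2].  The law of [R] has density [r^2 / 2] with respect to the
    measure [- d psi''], which has an atom at [r = phi lam 0] when [b = 1 / 2],
    and the identity for [psi] follows from two integrations by parts.  The
    substitution [w = expR (- x)] turns everything into exponentials on
    [0 < x] and moves the singularity at [w = 0] to infinity. *)
Require Import Defs.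
From HB Require Import structures.
From mathcomp Require Import all_boot all_order all_algebra.
From mathcomp Require Import all_classical all_reals all_analysis.
From mathcomp Require Import measurable_realfun.
From mathcomp Require Import ring lra.
Import Order.TTheory GRing.Theory Num.Theory.
Import numFieldNormedType.Exports.
Local Open Scope classical_set_scope.
Local Open Scope ring_scope.

(** * The generator and the derivatives of its inverse in exponential coordinates *)

Section generator.
Context {R : realType}.
Implicit Types b x t : R.

(* [phi (- b) (expR (- x))]. *)
Definition gen b x : R :=
  (b + (1 - b) * expR (- x) - expR ((b - 1) * x)) / ((1 - b) * b).
Definition gen1 b x : R := expR ((b - 1) * x) * (1 - expR (- b * x)) / b.
(* [gslope], [gcurv] are [- psi'] and [psi''] at [gen b x], and [gdens] is
   minus the derivative of [gcurv] in [x]. *)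
Definition gslope b x : R := b * expR (- b * x) / (1 - expR (- b * x)).
Definition gcurv b x : R :=
  b ^+ 3 * expR ((1 - 2 * b) * x) / (1 - expR (- b * x)) ^+ 3.
Definition gdens b x : R :=
  gcurv b x *
  (2 * b - 1 + 3 * b * expR (- b * x) / (1 - expR (- b * x))).
(* A primitive of [- ((gen b x - t) ^+ 2 / 2 * gdens b x)], found by
   integrating by parts twice. *)
Definition gprim b t x : R :=
  (gen b x - t) ^+ 2 / 2 * gcurv b x + (gen b x - t) * gslope b x + expR (- x).

Lemma is_derive_expRM c x :
  is_derive x 1 (fun y : R => expR (c * y)) (c * expR (c * x)).
Proof.
have H : is_derive x 1 (fun y : R => c * y) c.
  apply: (is_derive_eq (is_deriveZ c (is_derive_id x (1 : R)))).
  by rewrite /GRing.scale/= mulr1.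
have := is_derive1_comp (is_derive_expR (c * x)) H.
by rewrite mulrC.
Qed.

Lemma is_derive_expRN x :
  is_derive x 1 (fun y : R => expR (- y)) (- expR (- x)).
Proof.
have := is_derive_expRM (-1) x; rewrite !mulN1r.
by under eq_fun do rewrite mulN1r.
Qed.

Lemma is_derive_gen b x : 0 < b < 1 -> is_derive x 1 (gen b) (gen1 b x).
Proof.
move=> /andP[b0 b1].
have d1 := is_derive_expRN x.
have d2 := is_derive_expRM (b-1) x.
rewrite /gen.
apply: is_derive_eq.
rewrite /gen1 mulrBr mulr1 -expRD -mulrDl.
have -> : (b - 1 - b) * x = - x by ring.
rewrite /GRing.scale /=; field.
by rewrite gt_eqF// subr_eq0 gt_eqF.
Qed.

Lemma expRNM_lt1 b x : 0 < b -> 0 < x -> 0 < 1 - expR (- b * x).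
Proof. by move=> b0 x0; rewrite subr_gt0 expR_lt1 mulNr oppr_lt0 mulr_gt0. Qed.

Lemma is_derive_V1B b x : 0 < b -> 0 < x ->
  is_derive x 1 (fun y => (1 - expR (- b * y))^-1)
    (- (b * expR (- b * x)) * ((1 - expR (- b * x))^-1) ^+ 2).
Proof.
move=> b0 x0; have V1 := expRNM_lt1 b x b0 x0.
have d1 := is_derive_expRM (- b) x.
apply: is_derive_eq; [apply: is_deriveV; by rewrite gt_eqF|].
rewrite /GRing.scale/= exprVn; ring.
Qed.

Lemma is_derive_gslope b x : 0 < b < 1 -> 0 < x ->
  is_derive x 1 (gslope b) (- (gen1 b x * gcurv b x)).
Proof.
move=> /andP[b0 b1] x0.
have V1 := expRNM_lt1 b x b0 x0.
have d1 := is_derive_expRM (- b) x.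
have dV := is_derive_V1B b x b0 x0.
rewrite /gslope; apply: is_derive_eq.
rewrite /gen1 /gcurv /GRing.scale/=.
(* Splitting into the exponentials of [gen1] and [gcurv] leaves a rational identity in these two. *)
have E : expR (- b * x) = expR ((b - 1) * x) * expR ((1 - 2 * b) * x).
  by rewrite -expRD; congr expR; ring.
rewrite {}E in V1 *.
field.
by rewrite !gt_eqF.
Qed.

Lemma is_derive_gcurv b x : 0 < b < 1 -> 0 < x ->
  is_derive x 1 (gcurv b) (- gdens b x).
Proof.
move=> /andP[b0 b1] x0.
have V1 := expRNM_lt1 b x b0 x0.
have d1 := is_derive_expRM (1 - 2 * b) x.
have dV := is_derive_V1B b x b0 x0.
rewrite /gcurv; under eq_fun do rewrite -exprVn.
apply: is_derive_eq.
rewrite /gdens /gcurv /GRing.scale/=.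
field.
by rewrite gt_eqF.
Qed.

Lemma is_derive_gprim b t x : 0 < b < 1 -> 0 < x ->
  is_derive x 1 (gprim b t) (- ((gen b x - t) ^+ 2 / 2 * gdens b x)).
Proof.
move=> b01 x0.
have dp := is_derive_gen b x b01.
have dm := is_derive_gslope b x b01 x0.
have dg := is_derive_gcurv b x b01 x0.
have de := is_derive_expRN x.
rewrite /gprim.
apply: is_derive_eq.
(* The chain rule for [psi (gen b x) = expR (- x)]; the product cancels the derivative of the last
   summand of [gprim], and the two terms with [gen1 b x * gcurv b x] cancel each other. *)
have E : gen1 b x * gslope b x = expR (- x).
  case/andP : b01 => b0 b1.
  have V1 := expRNM_lt1 b x b0 x0.
  have -> : - x = (b - 1) * x + (- b * x) by ring.
  rewrite expRD /gen1 /gslope; field.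
  by rewrite !gt_eqF.
rewrite /GRing.scale/=.
by rewrite -E; field.
Qed.

(* The limit of [psi''] at [phi lam 0], the mass of the atom of [- d psi'']. *)
Definition gatom b : R := if b == 1 / 2 then 1 / 8 else 0.

Lemma gatom_ge0 b : 0 <= gatom b.
Proof. by rewrite /gatom; case: ifP => // _; rewrite divr_ge0. Qed.

(** This is the monotonicity of [psi'']: [1 / 2 <= b] makes the summand [2 * b - 1] nonnegative, and
    all other factors are positive. *)
Lemma gdens_ge0 b x : 1 / 2 <= b -> 0 < x -> 0 <= gdens b x.
Proof.
move=> b2 x0; have b0 : 0 < b by lra.
have V1 := expRNM_lt1 b x b0 x0.
rewrite /gdens /gcurv mulr_ge0//.
  by rewrite mulr_ge0 ?invr_ge0 ?exprn_ge0 ?mulr_ge0 ?expR_ge0 ?exprn_ge0 ?ltW.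
apply: addr_ge0; first lra.
by rewrite mulr_ge0 ?invr_ge0 ?mulr_ge0 ?expR_ge0 ?ltW.
Qed.

Lemma cvg_expRMy c : c < 0 -> expR (c * x) @[x --> +oo] --> (0 : R).
Proof.
move=> c0.
have H : (- c) * x @[x --> +oo%R] --> +oo%R.
  by apply: gt0_cvgMry => //; rewrite ?oppr_gt0//; exact: cvg_id.
have -> : (fun x => expR (c * x)) = (fun x => expR (- x)) \o (fun x => - c * x).
  by apply/funext => x /=; rewrite mulNr opprK.
exact: (cvg_comp _ _ H (@cvgr_expR R)).
Qed.

(** Both exponentials die out. The limit is [phi lam 0] for [lam = - b], since [x] at infinity
    stands for [w = 0]. *)
Lemma cvg_geny b : 0 < b < 1 -> gen b x @[x --> +oo] --> (1 - b)^-1.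
Proof.
move=> /andP[b0 b1].
have -> : (1 - b)^-1 = (b + (1 - b) * 0 - 0) / ((1 - b) * b).
  by field; rewrite !gt_eqF// subr_gt0.
apply: cvgM; last exact: cvg_cst.
apply: cvgB; last by apply: cvg_expRMy; lra.
apply: cvgD; first exact: cvg_cst.
by apply: cvgM; [exact: cvg_cst|exact: cvgr_expR].
Qed.

Lemma cvg_V1By b : 0 < b -> (1 - expR (- b * x))^-1 @[x --> +oo] --> (1 : R).
Proof.
move=> b0; rewrite -{2}(invr1 R) -{2}(subr0 1).
apply: cvgV; first by rewrite subr0.
apply: cvgB; first exact: cvg_cst.
by apply: cvg_expRMy; lra.
Qed.

Lemma cvg_gslopey b : 0 < b -> gslope b x @[x --> +oo] --> (0 : R).
Proof.
move=> b0; have -> : 0 = b * 0 * 1 :> R by rewrite mulr0 mul0r.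
apply: cvgM; last exact: cvg_V1By.
by apply: cvgM; [exact: cvg_cst|apply: cvg_expRMy; lra].
Qed.

(** The exponent [(1 - 2 * b) * x] is identically 0 for [b = 1 / 2], which leaves [b ^+ 3 = 1 / 8];
    for larger [b] it tends to minus infinity. *)
Lemma cvg_gcurvy b : 1 / 2 <= b -> gcurv b x @[x --> +oo] --> gatom b.
Proof.
move=> b2; have b0 : 0 < b by lra.
rewrite /gcurv; under eq_fun do rewrite -exprVn.
have V3 : (1 - expR (- b * x))^-1 ^+ 3 @[x --> +oo] --> (1 : R).
  rewrite -[X in _ --> X](expr1n R 3).
  exact: (cvg_comp _ _ (cvg_V1By b b0) (@exprn_continuous R 3 1)).
rewrite /gatom; case: eqP => [bh|/eqP bn].
  have -> : 1 / 8 = b ^+ 3 * 1 * 1 :> R by rewrite bh; field.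
  apply: cvgM; last exact: V3.
  apply: cvgM; first exact: cvg_cst.
  have -> : 1 - 2 * b = 0 by rewrite bh; field.
  by under eq_fun do rewrite mul0r expR0; exact: cvg_cst.
have -> : 0 = b ^+ 3 * 0 * 1 :> R by rewrite mulr0 mul0r.
apply: cvgM; last exact: V3.
apply: cvgM; first exact: cvg_cst.
have bb : 1 / 2 < b by rewrite lt_neqAle eq_sym bn.
by apply: cvg_expRMy; lra.
Qed.

(** [gslope b x] and [expR (- x)] vanish at infinity, so only the first summand of [gprim] can
    survive; it becomes the contribution of the atom. *)
Lemma cvg_gprimy b t : 1 / 2 <= b < 1 ->
  gprim b t x @[x --> +oo] --> ((1 - b)^-1 - t) ^+ 2 / 2 * gatom b.
Proof.
move=> /andP[b2 b1]; have b0 : 0 < b by lra.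
have b01 : 0 < b < 1 by rewrite b0.
have pt : gen b x - t @[x --> +oo] --> (1 - b)^-1 - t.
  by apply: cvgB; [exact: cvg_geny|exact: cvg_cst].
rewrite -[X in _ --> X]addr0.
apply: cvgD; last exact: cvgr_expR.
rewrite -[X in _ --> X]addr0.
apply: cvgD; last first.
  rewrite -(mulr0 ((1 - b)^-1 - t)).
  by apply: cvgM; [exact: pt|exact: cvg_gslopey].
apply: cvgM; last exact: cvg_gcurvy.
apply: cvgM; last exact: cvg_cst.
exact: (cvg_comp _ _ pt (@exprn_continuous R 2 _)).
Qed.

Lemma is_derive_continuous (f : R -> R) x d :
  is_derive x 1 f d -> {for x, continuous f}.
Proof.
by move=> D; apply: differentiable_continuous; apply/derivable1_diffP/ex_derive.
Qed.

Lemma continuous_gdens b x : 0 < b < 1 -> 0 < x ->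
  {for x, continuous (gdens b)}.
Proof.
move=> b01 x0; have /andP[b0 _] := b01.
have cV := is_derive_continuous _ _ _ (is_derive_V1B b x b0 x0).
have ce := is_derive_continuous _ _ _ (is_derive_expRM (- b) x).
rewrite /gdens; apply: continuousM.
  exact: is_derive_continuous (is_derive_gcurv b x b01 x0).
apply: continuousD; first exact: cvg_cst.
apply: continuousM; last exact: cV.
by apply: continuousM; [exact: cvg_cst|exact: ce].
Qed.

Lemma continuous_gen b x : 0 < b < 1 -> {for x, continuous (gen b)}.
Proof. by move=> b01; exact: is_derive_continuous (is_derive_gen b x b01). Qed.

(** Fundamental theorem of calculus for [- gprim b t] with [t = gen b x0]: at [x0] the terms with
    [gen b x - t] vanish and leave [expR (- x0)], and the limit at infinity gives the atom. *)
Lemma integral_gdens b x0 : 1 / 2 <= b < 1 -> 0 < x0 ->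
  (\int[lebesgue_measure]_(x in `[x0, +oo[)
     ((gen b x - gen b x0) ^+ 2 / 2 * gdens b x)%:E =
   (expR (- x0) - ((1 - b)^-1 - gen b x0) ^+ 2 / 2 * gatom b)%:E)%E.
Proof.
move=> b21 x00; have /andP[b2 b1] := b21; have b0 : 0 < b by lra.
have b01 : 0 < b < 1 by rewrite b0.
set t := gen b x0.
have cf x : 0 < x ->
    {for x, continuous (fun x => (gen b x - t) ^+ 2 / 2 * gdens b x)}.
  move=> xp; apply: continuousM; last exact: continuous_gdens.
  apply: continuousM; last exact: cvg_cst.
  have ct : {for x, continuous (fun x => gen b x - t)}.
    by apply: continuousB; [exact: continuous_gen|exact: cvg_cst].
  exact: (continuous_comp ct (@exprn_continuous R 2 _)).
have dF x : 0 < x ->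
    is_derive x 1 (- gprim b t) ((gen b x - t) ^+ 2 / 2 * gdens b x).
  move=> xp; have D := is_derive_gprim b t x b01 xp.
  by apply: is_derive_eq; rewrite opprK.
rewrite (@ge0_continuous_FTC2y _ _ (- gprim b t)
  _ (- (((1 - b)^-1 - t) ^+ 2 / 2 * gatom b))).
- rewrite -EFinD; congr EFin.
  rewrite [(- gprim b t) x0]/GRing.opp/= opprK /gprim -/t subrr; ring.
- move=> x xx0; rewrite mulr_ge0 ?gdens_ge0//; last lra.
  by rewrite divr_ge0// sqr_ge0.
- apply/continuous_in_subspaceT => x; rewrite inE/= => /andP[xx0 _].
  exact: cf (lt_le_trans x00 xx0).
- by apply: cvgN; exact: cvg_gprimy.
- move=> x xx0; have D := dF x (lt_trans x00 xx0); exact: ex_derive.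
- apply: cvg_at_right_filter.
  exact: is_derive_continuous (dF x0 x00).
- move=> x /andP[xx0 _].
  have D := dF x (lt_trans x00 xx0).
  by rewrite derive1E derive_val.
Qed.

End generator.

(** * Monotonicity and range of the generator; the pseudoinverse *)

Section pseudo_inverse.
Context {R : realType}.
Implicit Types b x y t u lam : R.

Lemma gen0 b : gen b 0 = 0.
Proof.
by rewrite /gen oppr0 mulr0 expR0 mulr1 addrCA subrr addr0 subrr mul0r.
Qed.

Lemma gen1_gt0 b x : 0 < b < 1 -> 0 < x -> 0 < gen1 b x.
Proof.
move=> /andP[b0 b1] x0.
by rewrite /gen1 divr_gt0// mulr_gt0 ?expR_gt0 ?expRNM_lt1.
Qed.

Lemma gen_lt b x y : 0 < b < 1 -> 0 <= x -> x < y -> gen b x < gen b y.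
Proof.
move=> b01 x0 xy; rewrite -subr_gt0.
have [||c] := @MVT R (gen b) (gen1 b) x y xy.
- by move=> z _; exact: is_derive_gen.
- by apply: continuous_subspaceT => z; exact: continuous_gen.
move=> /andP[xc cy] ->.
by rewrite mulr_gt0 ?subr_gt0 ?gen1_gt0// (le_lt_trans x0).
Qed.

Lemma gen_le b x y : 0 < b < 1 -> 0 <= x -> x <= y -> gen b x <= gen b y.
Proof.
by move=> b01 x0; rewrite le_eqVlt => /predU1P[->//|xy]; rewrite ltW// gen_lt.
Qed.

Lemma gen_ltE b x y : 0 < b < 1 -> 0 <= x -> 0 <= y ->
  (gen b x < gen b y) = (x < y).
Proof.
move=> b01 x0 y0; have [xy|yx] := ltP x y; first exact: gen_lt.
by apply/negbTE; rewrite -leNgt gen_le.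
Qed.

Lemma gen_ge0 b x : 0 < b < 1 -> 0 <= x -> 0 <= gen b x.
Proof. by move=> b01 x0; rewrite -(gen0 b) gen_le. Qed.

Lemma gen_lt_max b x : 0 < b < 1 -> 0 <= x -> gen b x < (1 - b)^-1.
Proof.
move=> /andP[b0 b1] x0.
have -> : (1 - b)^-1 = b / ((1 - b) * b) by field; rewrite !gt_eqF// subr_gt0.
rewrite /gen ltr_pM2r ?invr_gt0 ?mulr_gt0 ?subr_gt0//.
rewrite -addrA gtrDl subr_lt0.
(* The chain is [(1 - b) * expR (- x) < expR (- x) <= expR ((b - 1) * x)]. *)
apply: (@lt_le_trans _ _ (expR (- x))).
  by rewrite gtr_pMl ?expR_gt0//; lra.
by rewrite ler_expR; nra.
Qed.

Lemma gen_surj b t : 0 < b < 1 -> 0 <= t < (1 - b)^-1 ->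
  exists2 x, 0 <= x & gen b x = t.
Proof.
move=> b01 /andP[t0 t1].
have [M [M0 tM]] : exists M, 0 <= M /\ t < gen b M.
  have H : \forall x \near +oo, t < gen b x.
    by apply: cvgr_gt t1; exact: cvg_geny.
  near (+oo%R : set_system R) => M; exists M; split; near: M => //.
  exact: nbhs_pinfty_ge.
have [||c /andP[c0 _] <-] := @IVT R (gen b) 0 M t M0.
- by apply: continuous_subspaceT => z; exact: continuous_gen.
- by rewrite gen0 ge_min t0/= le_max (ltW tM) orbT.
by exists c.
Unshelve. all: by end_near. Qed.

Lemma phi_expRN lam x : -1 < lam < 0 -> phi lam (expR (- x)) = gen (- lam) x.
Proof.
move=> /andP[l1 l0]; rewrite /phi /gen -expRM.
have -> : - x * (lam + 1) = (- lam - 1) * x by ring.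
by field; rewrite (lt_eqF l0) opprK gt_eqF//; lra.
Qed.

Lemma phi0 lam : -1 < lam < 0 -> phi lam 0 = (1 - (- lam))^-1.
Proof.
move=> /andP[l1 l0]; rewrite /phi powR0; last by rewrite gt_eqF//; lra.
by field; rewrite (lt_eqF l0) opprK gt_eqF//; lra.
Qed.

Lemma pos_le1_expRN u : 0 < u <= 1 -> exists2 x, 0 <= x & u = expR (- x).
Proof.
move=> /andP[u0 u1]; exists (- ln u); first by rewrite oppr_ge0 ln_le0.
by rewrite opprK lnK.
Qed.

Section range.
Variable lam : R.
Hypothesis lam01 : -1 < lam < 0.
Let b := - lam.

Let b01 : 0 < b < 1. Proof. by move: lam01; rewrite /b; lra. Qed.

Lemma phi_pinv_gen x : 0 <= x -> phi_pinv lam (gen b x) = expR (- x).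
Proof.
move=> x0; rewrite /phi_pinv phi0// gen_ge0// gen_lt_max//=.
apply: xget_unique => /=.
  by rewrite phi_expRN// expR_ge0 expR_le1 oppr_le0.
(* The point [y = 0] is not an exponential; it is excluded because [phi lam 0] lies strictly above
   every [gen b x] with [0 <= x]. *)
move=> y [/andP[y0 y1]]; move: y0; rewrite le_eqVlt => /predU1P[<-|y0].
  by rewrite phi0// => E; have := gen_lt_max b x b01 x0; rewrite -E ltxx.
have [|z z0 ->] := pos_le1_expRN y; first by rewrite y0.
rewrite phi_expRN// => E; congr (expR (- _)).
have [| |//] := ltgtP z x.
- by rewrite -(gen_ltE b)// E ltxx.
- by rewrite -(gen_ltE b)// E ltxx.
Qed.

Lemma phi_pinv_ge t : (1 - b)^-1 <= t -> phi_pinv lam t = 0.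
Proof. by move=> bt; rewrite /phi_pinv phi0// [t < _]ltNge bt andbF. Qed.

Lemma phi_pinv0 : phi_pinv lam 0 = 1.
Proof. by rewrite -(gen0 b) phi_pinv_gen// oppr0 expR0. Qed.

Lemma phi_ge0 u : 0 <= u <= 1 -> 0 <= phi lam u.
Proof.
move=> /andP[u0 u1]; move: u0; rewrite le_eqVlt => /predU1P[<-|u0].
  by rewrite phi0// invr_ge0; move: b01; rewrite /b; lra.
have [|x x0 ->] := pos_le1_expRN u; first by rewrite u0.
by rewrite phi_expRN// gen_ge0.
Qed.

Lemma phi_pinv_ge0 t : 0 <= t -> 0 <= phi_pinv lam t.
Proof.
move=> t0; have [tb|bt] := ltP t (1 - b)^-1; last by rewrite phi_pinv_ge.
have [|x x0 <-] := gen_surj b t b01; first by rewrite t0.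
by rewrite phi_pinv_gen// expR_ge0.
Qed.

(** A Galois connection of decreasing maps, valid also at [u = 0] and for [t] beyond [phi lam 0]. It
    turns events about [psi X] into thresholds for [X]. *)
Lemma phi_pinv_le t u : 0 <= t -> 0 <= u <= 1 ->
  (phi_pinv lam t <= u) = (phi lam u <= t).
Proof.
move=> t0 /andP[u0 u1]; have [tb|bt] := ltP t (1 - b)^-1; last first.
  rewrite phi_pinv_ge// u0; symmetry.
  move: u0; rewrite le_eqVlt => /predU1P[<-|u0]; first by rewrite phi0.
  have [|x x0 ->] := pos_le1_expRN u; first by rewrite u0.
  by rewrite phi_expRN// (le_trans _ bt)// ltW// gen_lt_max.
have [|x x0 <-] := gen_surj b t b01; first by rewrite t0.
rewrite phi_pinv_gen//.
move: u0; rewrite le_eqVlt => /predU1P[<-|u0].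
  by rewrite phi0// leNgt expR_gt0 leNgt gen_lt_max.
have [|y y0 ->] := pos_le1_expRN u; first by rewrite u0.
by rewrite phi_expRN// ler_expR lerN2 !leNgt gen_ltE.
Qed.

Lemma phi1 : phi lam 1 = 0.
Proof. by have := phi_expRN lam 0 lam01; rewrite oppr0 expR0 gen0. Qed.

Lemma phi_pinv_le1 t : 0 <= t -> phi_pinv lam t <= 1.
Proof.
by move=> t0; rewrite phi_pinv_le ?phi1// ler01 lexx.
Qed.

Lemma phi_pinvK u : 0 <= u <= 1 -> phi_pinv lam (phi lam u) = u.
Proof.
move=> /andP[u0 u1]; move: u0; rewrite le_eqVlt => /predU1P[<-|u0].
  by rewrite phi0// phi_pinv_ge.
have [|y y0 ->] := pos_le1_expRN u; first by rewrite u0.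
by rewrite phi_expRN// phi_pinv_gen.
Qed.

End range.
End pseudo_inverse.

(** * The radial law and its integral representation of the pseudoinverse *)

Section radial.
Context {R : realType}.
Implicit Types b x y t u lam : R.

(* The radial part of the copula lives on the line: the half-line [x > 0]
   carries its absolutely continuous part in the coordinate [w = expR (- x)],
   and [-1 < x <= 0] carries its atom, present only for [b = 1 / 2]. *)
Definition wdens b x : R :=
  if x <= 0 then if -1 < x then gatom b else 0 else gdens b x.
Definition wrad b x : R := if x <= 0 then (1 - b)^-1 else gen b x.
(** For [r = wrad b x > 0], the weight [r ^ 2 / 2] times [(1 - t / r)_+ ^ 2] is
    [(r - t)_+ ^ 2 / 2]. *)
Definition wint b t x : R := wdens b x * ((Num.max 0 (wrad b x - t)) ^+ 2 / 2).

Lemma wdens_ge0 b x : 1 / 2 <= b -> 0 <= wdens b x.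
Proof.
move=> b2; rewrite /wdens; case: (leP x 0) => [x0|x0]; last exact: gdens_ge0.
by case: ifP => // _; exact: gatom_ge0.
Qed.

Lemma wint_ge0 b t x : 1 / 2 <= b -> 0 <= wint b t x.
Proof. by move=> b2; rewrite mulr_ge0 ?wdens_ge0// divr_ge0// sqr_ge0. Qed.

Lemma measurable_wdens b : 0 < b < 1 -> measurable_fun setT (wdens b).
Proof.
move=> b01; apply: measurable_fun_if => //.
- by apply: measurable_fun_ler => //; exact: measurable_cst.
- apply: measurable_funTS; apply: measurable_fun_ifT; try exact: measurable_cst.
  by apply: measurable_fun_ltr => //; exact: measurable_cst.
- rewrite setTI (_ : _ @^-1` _ = `]0, +oo[%classic).
    apply: open_continuous_measurable_fun; first exact: interval_open.
    move=> x; rewrite inE/= => /andP[x0 _]; exact: continuous_gdens.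
  apply/seteqP; split => x /=; rewrite in_itv/= andbT ltNge.
    by move=> ->.
  by move/negbTE.
Qed.

Lemma measurable_wrad b : 0 < b < 1 -> measurable_fun setT (wrad b).
Proof.
move=> b01; apply: measurable_fun_ifT => //.
- by apply: measurable_fun_ler => //; exact: measurable_cst.
- by apply: continuous_measurable_fun => x; exact: continuous_gen.
Qed.

Lemma measurable_wint b t : 0 < b < 1 -> measurable_fun setT (wint b t).
Proof.
move=> b01; apply: measurable_funM; first exact: measurable_wdens.
apply: measurable_funM => //; apply: measurable_funX.
apply: measurable_maxr => //.
by apply: measurable_funB => //; exact: measurable_wrad.
Qed.

Notation mu := (@lebesgue_measure R).

Lemma integral_wint_split b t : 1 / 2 <= b < 1 ->
  (\int[mu]_x (wint b t x)%:E =
   (gatom b * ((Num.max 0 ((1 - b)^-1 - t)) ^+ 2 / 2))%:E +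
   \int[mu]_(x in `]0%R, +oo[) (wint b t x)%:E)%E.
Proof.
move=> /andP[b2 b1]; have b01 : 0 < b < 1 by rewrite b1 andbT; lra.
rewrite -set_itvNyy (@itv_bndbnd_setU _ _ _ (BRight 0))//.
have mw D : measurable_fun D (fun x => (wint b t x)%:E).
  apply: measurable_funTS; apply/measurable_EFinP; exact: measurable_wint.
rewrite ge0_integral_setU//=; first last.
- apply/disj_setPS => x [/=]; rewrite !in_itv/= andbT => x0 x1.
  by move: x1; rewrite ltNge x0.
- by move=> x _; rewrite lee_fin wint_ge0.
- exact: mw.
congr (_ + _)%E.
set c := gatom b * _.
(* The integrand is 0 up to -1 and constant on the following interval of length 1, so the atom
   contributes exactly [c]. *)
transitivity (\int[mu]_(x in `](-1)%R, 0%R]) (cst c%:E) x)%E; last first.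
  rewrite integral_cst//= lebesgue_measure_itv/= lte_fin ltrN10.
  by rewrite -EFinD sub0r opprK mule1.
rewrite integral_mkcond [RHS]integral_mkcond; apply: eq_integral => x _.
rewrite !patchE !mem_setE !in_itv/= /wint /wdens /wrad.
case: ifPn => [x0|]; rewrite ?andbF//.
by rewrite x0 andbT; case: ifP => // _; rewrite mul0r.
Qed.

(** As [gen b] increases, the positive part cuts the half-line down to [x0 <= x]; the atom then
    cancels the correction term in [integral_gdens]. *)
Lemma integral_wint_gt0 b x0 : 1 / 2 <= b < 1 -> 0 < x0 ->
  (\int[mu]_x (wint b (gen b x0) x)%:E = (expR (- x0))%:E)%E.
Proof.
move=> b21 x00; have /andP[b2 b1] := b21.
have b01 : 0 < b < 1 by rewrite b1 andbT; lra.
rewrite integral_wint_split//.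
have -> : (\int[mu]_(x in `]0%R, +oo[) (wint b (gen b x0) x)%:E =
  \int[mu]_(x in `[x0, +oo[)
     ((gen b x - gen b x0) ^+ 2 / 2 * gdens b x)%:E)%E.
  rewrite integral_mkcond [RHS]integral_mkcond; apply: eq_integral => x _.
  rewrite !patchE !mem_setE !in_itv/= !andbT /wint /wdens /wrad.
  have [xp|xn] := ltP 0 x; last by rewrite leNgt (le_lt_trans xn x00).
  have [xx0|xx0] := leP x0 x.
    rewrite max_r ?subr_ge0; last exact: gen_le (ltW x00) xx0.
    by rewrite mulrC.
  rewrite max_l ?subr_le0; last exact: gen_le (ltW xp) (ltW xx0).
  by rewrite expr0n/= mul0r mulr0.
rewrite integral_gdens// max_r ?subr_ge0; last first.
  by rewrite ltW// gen_lt_max// ltW.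
by rewrite -EFinD; congr EFin; ring.
Qed.

Lemma integral_wint_ge b t : 1 / 2 <= b < 1 -> (1 - b)^-1 <= t ->
  (\int[mu]_x (wint b t x)%:E = 0)%E.
Proof.
move=> /andP[b2 b1] bt; have b01 : 0 < b < 1 by rewrite b1 andbT; lra.
apply: integral0_eq => x _; rewrite /wint max_l ?expr0n/= ?mul0r ?mulr0//.
rewrite subr_le0 (le_trans _ bt)// /wrad; case: (leP x 0) => // x0.
by rewrite ltW// gen_lt_max// ltW.
Qed.

Lemma continuous_max0 : continuous (Num.max (0 : R)).
Proof.
move=> x; have : (fun y : R => Num.max (cst 0 y) (id y)) @ x --> Num.max 0 x.
  by apply: (@continuous_max _ _ (cst 0) id x); [exact: cvg_cst|exact: cvg_id].
by [].
Qed.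

(** [gcurv] and [gslope] are singular at [x = 0], so the value at [t = 0] is reached by monotone
    convergence along levels [s n] decreasing to 0. *)
Lemma integral_wint0 b : 1 / 2 <= b < 1 -> (\int[mu]_x (wint b 0 x)%:E = 1)%E.
Proof.
move=> b21; have /andP[b2 b1] := b21.
have b01 : 0 < b < 1 by rewrite b1 andbT; lra.
pose s n : R := gen b n.+1%:R^-1.
have s_dec m n : (m <= n)%N -> s n <= s m.
  by move=> mn; rewrite gen_le ?invr_ge0// lef_pV2 ?posrE// ler_nat.
have s0 : s n @[n --> \oo] --> 0.
  rewrite -(gen0 b); apply: (cvg_comp _ _ (@cvg_harmonic R)).
  exact: continuous_gen.
have e1 : expR (- n.+1%:R^-1) @[n --> \oo] --> (1 : R).
  rewrite -[X in _ --> X]expR0 -[X in expR X]oppr0.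
  apply: (@cvg_comp _ _ _ (fun n : nat => - (n.+1%:R^-1 : R)) expR).
    by apply: cvgN; exact: cvg_harmonic.
  exact: continuous_expR.
have e2 : (\int[mu]_x (wint b (s n) x)%:E @[n --> \oo] --> 1)%E.
  under eq_fun do rewrite integral_wint_gt0 ?invr_gt0//.
  by apply: cvg_EFin => //; near=> n.
have Mon : (\int[mu]_x (wint b (s n) x)%:E @[n --> \oo] -->
    \int[mu]_x (limn (fun n => (wint b (s n) x)%:E)))%E.
  apply: (@cvg_monotone_convergence _ _ R mu setT measurableT
    (fun n x => (wint b (s n) x)%:E)).
  - by move=> n; apply/measurable_EFinP; exact: measurable_wint.
  - by move=> n x _; rewrite lee_fin wint_ge0.
  - move=> x _ m n mn; rewrite lee_fin ler_wpM2l ?wdens_ge0//.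
    rewrite ler_pM2r ?invr_gt0//.
    apply: lerXn2r; [by rewrite nnegrE le_max lexx..|].
    by rewrite ge_max !le_max lexx/= lerD2l lerN2 s_dec ?orbT.
rewrite [RHS](cvg_unique _ e2 Mon)//.
apply: eq_integral => x _; apply/esym/cvg_lim => //.
apply: cvg_EFin; first by near=> n.
apply: cvgM; first exact: cvg_cst.
apply: cvgM; last exact: cvg_cst.
have H : Num.max 0 (wrad b x - s n) @[n --> \oo] --> Num.max 0 (wrad b x - 0).
  apply: (@cvg_comp _ _ _ (fun n => wrad b x - s n) (Num.max 0)).
    by apply: cvgB; [exact: cvg_cst|exact: s0].
  exact: continuous_max0.
exact: (cvg_comp _ _ H (@exprn_continuous R 2 _)).
Unshelve. all: by end_near. Qed.

End radial.

(** * Simplex mixtures as regions under Lebesgue measure on three-dimensional space *)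

Section simplex.
Context {R : realType}.
Notation mu := (@lebesgue_measure R).

(** The lengths of the slices of a triangle form a ramp; this sums them up to its area, times the
    weight [k]. *)
Lemma integral_ramp (k a c : R) :
  (\int[mu]_(s in `[c, +oo[) (k * Num.max 0 (a - s))%:E =
   (k * (Num.max 0 (a - c) ^+ 2 / 2))%:E)%E.
Proof.
have [ca|ac] := ltP c a; last first.
  rewrite max_l ?subr_le0// expr0n/= mul0r mulr0.
  apply: integral0_eq => s; rewrite /= in_itv/= andbT => cs.
  by rewrite max_l ?mulr0// subr_le0 (le_trans ac).
have -> : (\int[mu]_(s in `[c, +oo[) (k * Num.max 0 (a - s))%:E =
  \int[mu]_(s in `[c, a]) (k * (a - s))%:E)%E.
  rewrite integral_mkcond [RHS]integral_mkcond; apply: eq_integral => s _.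
  rewrite !patchE !mem_setE !in_itv/= andbT; case: (leP c s) => //= _.
  have [sa|as_] := leP s a; first by rewrite max_r// subr_ge0.
  by rewrite max_l ?mulr0// subr_le0 ltW.
have dF (x : R) :
    is_derive x 1 (fun s : R => - (k * ((a - s) ^+ 2 / 2))) (k * (a - x)).
  apply: is_derive_eq; rewrite /GRing.scale/=.
  by field.
have cf : continuous (fun s : R => k * (a - s)).
  move=> x; apply: cvgM; first exact: cvg_cst.
  by apply: cvgB; [exact: cvg_cst|exact: cvg_id].
rewrite (@continuous_FTC2 _ _ (fun s : R => - (k * ((a - s) ^+ 2 / 2))))//.
- rewrite -EFinD; congr EFin; rewrite max_r ?subr_ge0 ?ltW//; ring.
- exact: continuous_subspaceT.
- split.
  + by move=> x _; have D := dF x; exact: ex_derive.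
  + by apply: cvg_at_right_filter; exact: is_derive_continuous (dF c).
  + by apply: cvg_at_left_filter; exact: is_derive_continuous (dF a).
- by move=> x _; have D := dF x; rewrite derive1E derive_val.
Qed.

Lemma probability_of_measure d (T : measurableType d)
    (m : {measure set T -> \bar R}) :
  m setT = 1%E -> exists P : probability T R, forall A, P A = m A.
Proof.
(* Normalising a total mass of 1 leaves [m] unchanged; [dirac point] is the fallback for mass 0 or
   infinity. *)
move=> m1; exists (mnormalize m (dirac point)) => A.
by rewrite /= /mnormalize m1 onee_eq0/= invr1 mule1.
Qed.

Variables (K rho : R -> R).
Hypotheses (mK : measurable_fun setT K) (mrho : measurable_fun setT rho).

(* In the slice at [x] the point [(s, q / K x, rho x - s - q / K x)] runs over
   the simplex of size [rho x]; storing the second coordinate multiplied by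
   [K x] makes the weight [K x] part of plain Lebesgue measure. *)
Definition simplex_region (c1 c2 c3 : R) : set ((R * R) * R) :=
  [set z | [/\ 0 < K z.1.1, c1 <= z.1.2, c2 * K z.1.1 <= z.2 &
               z.2 <= K z.1.1 * (rho z.1.1 - z.1.2 - c3)]].

Let mx : measurable_fun [set: (R * R) * R] (fun z => z.1.1).
Proof. exact: (measurableT_comp measurable_fst). Qed.
Let ms : measurable_fun [set: (R * R) * R] (fun z => z.1.2).
Proof. exact: (measurableT_comp measurable_snd). Qed.
Let mKx : measurable_fun [set: (R * R) * R] (fun z => K z.1.1).
Proof. exact: (measurableT_comp mK). Qed.
Let mrx : measurable_fun [set: (R * R) * R] (fun z => rho z.1.1).
Proof. exact: (measurableT_comp mrho). Qed.

Lemma measurable_simplex_region c1 c2 c3 : measurable (simplex_region c1 c2 c3).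
Proof.
rewrite (_ : simplex_region _ _ _ = (fun z : (R * R) * R =>
  [&& 0 < K z.1.1, c1 <= z.1.2, c2 * K z.1.1 <= z.2 &
               z.2 <= K z.1.1 * (rho z.1.1 - z.1.2 - c3)]) @^-1` [set true]).
  rewrite -[X in measurable X]setTI.
  suff : measurable_fun [set: (R * R) * R] (fun z =>
    [&& 0 < K z.1.1, c1 <= z.1.2, c2 * K z.1.1 <= z.2 &
               z.2 <= K z.1.1 * (rho z.1.1 - z.1.2 - c3)]) by exact.
  repeat apply: measurable_and.
  - by apply: measurable_fun_ltr => //; exact: mKx.
  - by apply: measurable_fun_ler => //; exact: ms.
  - apply: measurable_fun_ler => //; apply: measurable_funM => //; exact: mKx.
  - apply: measurable_fun_ler => //; apply: measurable_funM; first exact: mKx.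
    apply: measurable_funB => //.
    by apply: measurable_funB; [exact: mrx|exact: ms].
by apply/seteqP; split => z /=; [move=> [-> -> -> ->]|move/and4P].
Qed.

(** For [0 < K x] and [c1 <= s] the section is an interval, possibly empty, whence the maximum with
    0. For [K x = 0] the section is empty and the weight vanishes too. *)
Lemma xsection_simplex_region c1 c2 c3 x s : 0 <= K x ->
  mu (xsection (simplex_region c1 c2 c3) (x, s)) =
  (if (c1 <= s)%R then (K x * Num.max 0 (rho x - c2 - c3 - s))%:E else 0)%E.
Proof.
rewrite le_eqVlt => /predU1P[K0|K0].
  rewrite -K0 mul0r if_same (_ : xsection _ _ = set0) ?measure0//.
  apply/seteqP; split => q //; rewrite xsectionE/= /simplex_region/=.
  by rewrite -K0 ltxx => -[].
case: ifPn => cs; last first.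
  rewrite (_ : xsection _ _ = set0) ?measure0//.
  apply/seteqP; split => q //; rewrite xsectionE/= /simplex_region/=.
  by rewrite (negbTE cs) => -[].
rewrite (_ : xsection _ _ = `[c2 * K x, K x * (rho x - s - c3)]%classic).
  rewrite lebesgue_measure_itv/= lte_fin mulrC ltr_pM2l//.
  have [lt|le] := ltP c2.
    rewrite max_r; last by lra.
    by rewrite -EFinD; congr EFin; ring.
  by rewrite max_l ?mulr0//; lra.
apply/seteqP; split => q; rewrite xsectionE/= /simplex_region/= in_itv/=.
  by move=> [_ _ -> ->].
by move=> /andP[-> ->].
Qed.

(** Tonelli: integrating the section lengths over [s] gives, for each [x], [K x] times the area of a
    right triangle with both legs [rho x - (c1 + c2 + c3)], or 0 if that is negative. *)
Lemma simplex_region_measure c1 c2 c3 : (forall x, 0 <= K x) ->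
  ((mu \x mu) \x mu)%E (simplex_region c1 c2 c3) =
  (\int[mu]_x (K x * (Num.max 0 (rho x - (c1 + c2 + c3)) ^+ 2 / 2))%:E)%E.
Proof.
move=> K0.
have mB := measurable_simplex_region c1 c2 c3.
have mf : measurable_fun setT (mu \o xsection (simplex_region c1 c2 c3)).
  exact: measurable_fun_xsection.
rewrite [LHS](@fubini_tonelli1 _ _ _ _ _ mu mu _ mf)//.
apply: eq_integral => x _; rewrite /fubini_F/=.
under eq_integral do rewrite xsection_simplex_region//.
have -> : rho x - (c1 + c2 + c3) = (rho x - c2 - c3) - c1 by ring.
rewrite -integral_ramp [RHS]integral_mkcond; apply: eq_integral => s _.
by rewrite patchE mem_setE in_itv/= andbT.
Qed.

End simplex.

(** * Construction of the random vector and its distribution function *)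

Section copula.
Context {R : realType}.
Notation mu := (@lebesgue_measure R).
Variable lam : R.
Hypotheses (lam1 : -1 < lam) (lam2 : lam <= - (1 / 2)).
Let b := - lam.
Let K := wdens b.
Let rho := wrad b.

Let lam01 : -1 < lam < 0. Proof. by rewrite lam1/=; move: lam2; lra. Qed.
Let b21 : 1 / 2 <= b < 1. Proof. by rewrite /b; move: lam1 lam2; lra. Qed.
Let b01 : 0 < b < 1. Proof. by rewrite /b; move: lam1 lam2; lra. Qed.

(** The representation [psi t = E ((1 - t / R)_+ ^ 2)], assembled from the cases [t] beyond
    [phi lam 0], [t = 0] and [t = gen b x] with [0 < x]. *)
Lemma integral_wint_phi_pinv t : 0 <= t ->
  (\int[mu]_x (wint b t x)%:E = (phi_pinv lam t)%:E)%E.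
Proof.
move=> t0; have [tb|bt] := ltP t (1 - b)^-1; last first.
  by rewrite integral_wint_ge// phi_pinv_ge.
have [|x x0 <-] := gen_surj b t b01; first by rewrite t0.
rewrite phi_pinv_gen//; move: x0; rewrite le_eqVlt => /predU1P[<-|x0].
  by rewrite gen0 oppr0 expR0 integral_wint0.
by rewrite integral_wint_gt0.
Qed.

(** Clipping matters: [phi_pinv lam] is 0 at negative arguments but 1 at 0. Monotonicity on the
    whole line is used to get measurability. *)
Lemma phi_pinv_max_nonincreasing :
  nonincreasing_fun (fun t => phi_pinv lam (Num.max 0 t)).
Proof.
have m0 (t : R) : 0 <= Num.max 0 t by rewrite le_max lexx.
have p01 t : 0 <= phi_pinv lam (Num.max 0 t) <= 1.
  by rewrite phi_pinv_ge0// phi_pinv_le1.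
(* The Galois connection is applied in both directions, with the value at [s] as the bound. *)
move=> s t st /=; rewrite phi_pinv_le//.
apply: (@le_trans _ _ (Num.max 0 s)); first by rewrite -phi_pinv_le.
by rewrite ge_max !le_max lexx st orbT.
Qed.

Let psi t := phi_pinv lam (Num.max 0 t).

Let psi_le t u : 0 <= t -> 0 <= u <= 1 -> (psi t <= u) = (phi lam u <= t).
Proof. by move=> t0 u01; rewrite /psi max_r// phi_pinv_le. Qed.

Let mpsi d (T : measurableType d) (f : T -> R) :
  measurable_fun setT f -> measurable_fun setT (fun x => psi (f x)).
Proof.
have mp : measurable_fun setT psi.
  apply: nonincreasing_measurable => //; exact: phi_pinv_max_nonincreasing.
exact: measurableT_comp.
Qed.

Let M := ((mu \x mu) \x mu)%E.
Let B := simplex_region K rho.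

(** The joint survival function of the simplex mixture; it depends on the thresholds only through
    their sum. *)
Let M_B c1 c2 c3 : 0 <= c1 -> 0 <= c2 -> 0 <= c3 ->
  M (B c1 c2 c3) = (phi_pinv lam (c1 + c2 + c3))%:E.
Proof.
move=> c10 c20 c30; rewrite -integral_wint_phi_pinv ?addr_ge0//.
rewrite /M /B simplex_region_measure//.
- exact: measurable_wdens.
- exact: measurable_wrad.
- by move=> x; apply: wdens_ge0; move: b21 => /andP[].
Qed.

Let mB c1 c2 c3 : measurable (B c1 c2 c3).
Proof.
apply: measurable_simplex_region; first exact: measurable_wdens.
exact: measurable_wrad.
Qed.

(** The division by [K z.1.1] undoes the scaling of the second simplex coordinate; the third is what
    remains of the radius. *)
Let Y (z : (R * R) * R) : (R * R) * R :=
  (psi z.1.2, psi (z.2 / K z.1.1), psi (rho z.1.1 - z.1.2 - z.2 / K z.1.1)).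

Let mY : measurable_fun setT Y.
Proof.
have mK : measurable_fun [set: (R * R) * R] (fun z => K z.1.1).
  apply: (measurableT_comp (measurable_wdens _ b01)).
  exact: (measurableT_comp measurable_fst).
have mr : measurable_fun [set: (R * R) * R] (fun z => rho z.1.1).
  apply: (measurableT_comp (measurable_wrad _ b01)).
  exact: (measurableT_comp measurable_fst).
have ms : measurable_fun [set: (R * R) * R] (fun z => z.1.2).
  exact: (measurableT_comp measurable_snd).
have mq : measurable_fun [set: (R * R) * R] (fun z => z.2 / K z.1.1).
  apply: measurable_funM => //.
  (* For [K >= 0] the inverse is the power with exponent -1, including at 0 where both are 0, and
     powers are measurable. *)
  rewrite (_ : (fun z => _) = (fun z : (R * R) * R => K z.1.1 `^ (-1))).
    exact: (measurableT_comp (measurable_powR _) mK).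
  apply/funext => z; rewrite powR_inv1// wdens_ge0//.
  by case/andP: b21.
apply: measurable_fun_pair.
  by apply: measurable_fun_pair; [exact: mpsi ms|exact: mpsi mq].
apply: mpsi; apply: measurable_funB mq.
exact: measurable_funB mr ms.
Qed.

(** On [B 0 0 0] the three simplex coordinates are nonnegative, so [psi_le] turns each upper bound
    [u] into the lower threshold [phi lam u]. *)
Let YB u1 u2 u3 : 0 <= u1 <= 1 -> 0 <= u2 <= 1 -> 0 <= u3 <= 1 ->
  (Y @^-1` [set x | [/\ x.1.1 <= u1, x.1.2 <= u2 & x.2 <= u3]]) `&` B 0 0 0 =
  B (phi lam u1) (phi lam u2) (phi lam u3).
Proof.
move=> u10 u20 u30; apply/seteqP; split => [[[x s] q]|[[x s] q]].
  rewrite /Y /B /simplex_region /= => -[[h1 h2 h3] [K0 s0 q0 qr]].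
  rewrite mul0r in q0; rewrite subr0 in qr.
  have q'0 : 0 <= q / K x by rewrite divr_ge0// ltW.
  have r0 : 0 <= rho x - s - q / K x.
    by rewrite subr_ge0 ler_pdivrMr// mulrC.
  move: h1 h2 h3; rewrite !psi_le// => h1 h2 h3; split => //.
    by rewrite -ler_pdivlMr.
  by rewrite -ler_pdivrMl// mulrC lerBrDr addrC -lerBrDr.
rewrite /Y /B /simplex_region /= => -[K0 h1 h2 h3].
have p1 := phi_ge0 lam lam01 u1 u10.
have p2 := phi_ge0 lam lam01 u2 u20.
have p3 := phi_ge0 lam lam01 u3 u30.
have s0 : 0 <= s := le_trans p1 h1.
have q0 : 0 <= q by apply: le_trans h2; rewrite mulr_ge0// ltW.
have h2' : phi lam u2 <= q / K x by rewrite ler_pdivlMr.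
have h3' : phi lam u3 <= rho x - s - q / K x.
  by rewrite lerBrDr addrC -lerBrDr ler_pdivrMr// mulrC.
have q'0 := le_trans p2 h2'.
have r0 := le_trans p3 h3'.
rewrite !psi_le//; split; split => //; first by rewrite mul0r.
by rewrite subr0 mulrC -ler_pdivrMr// -subr_ge0.
Qed.

Let psi01 t : 0 <= psi t <= 1.
Proof.
have t0 : 0 <= Num.max 0 t by rewrite le_max lexx.
by rewrite phi_pinv_ge0// phi_pinv_le1.
Qed.

Let psi_clip t u : 0 <= u -> (psi t <= u) = (psi t <= Num.max 0 (Num.min u 1)).
Proof.
move=> u0; have /andP[_ p1] := psi01 t.
by rewrite max_r le_min ?u0 ?ler01// p1 andbT.
Qed.

Lemma C_lam_is_copula3 : is_copula3 (C_lam lam).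
Proof.
(* The law of [Y] under Lebesgue measure restricted to [B 0 0 0], whose mass is [psi 0 = 1]. *)
pose m : {measure set ((R * R) * R) -> \bar R} :=
  pushforward (mrestr M (mB 0 0 0)) Y.
have mE A : m mY A = M (Y @^-1` A `&` B 0 0 0) by [].
have [|P PE] := probability_of_measure _ _ (m mY).
  by rewrite mE preimage_setT setTI M_B// !addr0 phi_pinv0.
have I01 : 0 <= (1 : R) <= 1 by rewrite ler01 lexx.
have joint u1 u2 u3 : 0 <= u1 <= 1 -> 0 <= u2 <= 1 -> 0 <= u3 <= 1 ->
    P [set x | [/\ x.1.1 <= u1, x.1.2 <= u2 & x.2 <= u3]]
    = (C_lam lam u1 u2 u3)%:E.
  move=> u10 u20 u30.
  by rewrite PE mE YB// M_B// phi_ge0.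
have clip01 (u : R) : 0 <= Num.max 0 (Num.min u 1) <= 1.
  by rewrite le_max lexx/= ge_max ler01 ge_min lexx orbT.
have phi10 : phi lam 1 = 0 by exact: phi1.
(* For [0 <= u] a marginal event is replaced by a box [A] with the other bounds equal to 1, where
   [phi lam 1 = 0] makes [joint] collapse to [psi (phi u)]; for [u < 0] both sides are 0. *)
have margin (f : (R * R) * R -> R) u (A : set ((R * R) * R)) :
    (forall z, 0 <= f (Y z)) ->
    (0 <= u -> Y @^-1` [set x | f x <= u] = Y @^-1` A) ->
    P A = (Num.max 0 (Num.min u 1))%:E ->
    P [set x | f x <= u] = (Num.max 0 (Num.min u 1))%:E.
  move=> f0 fA PA; have [u0|u0] := leP 0 u; first by rewrite -PA !PE !mE fA.
  rewrite PE mE max_l; last by rewrite ge_min (ltW u0).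
  have -> : Y @^-1` [set x | f x <= u] = set0.
    by apply/seteqP; split => z //=; rewrite leNgt (lt_le_trans u0).
  by rewrite set0I; exact: (measure0 ((mu \x mu) \x mu)%E).
have psi_le1 t : psi t <= 1 by have /andP[] := psi01 t.
have psi_ge0 t : 0 <= psi t by have /andP[] := psi01 t.
exists P; split.
- move=> u; apply: (margin (fun x => x.1.1) u [set x |
    [/\ x.1.1 <= Num.max 0 (Num.min u 1), x.1.2 <= 1 & x.2 <= 1]]).
  + by move=> z; exact: psi_ge0.
  + by move=> u0; apply/seteqP; split => z /=; rewrite psi_clip//; case.
  + by rewrite joint// /C_lam phi10 !addr0 phi_pinvK.
- move=> u; apply: (margin (fun x => x.1.2) u [set x |
    [/\ x.1.1 <= 1, x.1.2 <= Num.max 0 (Num.min u 1) & x.2 <= 1]]).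
  + by move=> z; exact: psi_ge0.
  + by move=> u0; apply/seteqP; split => z /=; rewrite psi_clip//; case.
  + by rewrite joint// /C_lam phi10 addr0 add0r phi_pinvK.
- move=> u; apply: (margin (fun x => x.2) u [set x |
    [/\ x.1.1 <= 1, x.1.2 <= 1 & x.2 <= Num.max 0 (Num.min u 1)]]).
  + by move=> z; exact: psi_ge0.
  + by move=> u0; apply/seteqP; split => z /=; rewrite psi_clip//; case.
  + by rewrite joint// /C_lam phi10 !add0r phi_pinvK.
- exact: joint.
Qed.
End copula.

Theorem theorem6 (R : realType) (lam : R) :
  -1 < lam -> lam <= - (1 / 2) -> is_copula3 (C_lam lam).
Proof. exact: C_lam_is_copula3. Qed.
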